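(* Let $2\le s\le r\le n-2$ and let $P=P(m_1,\dots,m_{n-1})$ be a natural unit interval order with $m_1=r$, $m_2=\cdots=m_s=n-1$ and $m_{s+1}=\cdots=m_{n-1}=n$; let $G=\mathrm{inc}(P)$. Then $$X_G(\mathbf{x},t)=[n-4]_t!\left\{\overline{C}_n(t)\,e_n+\overline{C}_{(n-1,1)}(t)\,e_{(n-1,1)}+\overline{C}_{(n-2,2)}(t)\,e_{(n-2,2)}\right\},$$ where $\overline{C}_n(t)=[n]_t[n-3]_t[r-1]_t[n-s-1]_t$, $\overline{C}_{(n-2,2)}(t)=t^{n+r-s-3}[2]_t[n-r-1]_t[s-1]_t$, and $\overline{C}_{(n-1,1)}(t)=\tfrac12[n-2]_t\left\{t^{r-1}(1+t^{n-r-s})[n-3]_t+t^{n-s-1}[2]_t[r-2]_t[s-1]_t+t^{r-1}[2]_t[n-r-1]_t[n-s-2]_t\right\}$. Moreover $X_G(\mathbf{x},t)$ is $e$-positive and $e$-unimodal with center of symmetry $\frac{\binom{n}{2}-(n-r+s-1)}{2}$.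
   Context: A natural unit interval order $P(m_1,\dots,m_{n-1})$ is defined for integers $m_1\le\cdots\le m_{n-1}\le n$ with $m_i\ge i$: it is the poset on $[n]$ with $i<_P j$ iff $i<n$ and $j\in\{m_i+1,\dots,n\}$. Its incomparability graph has vertex set $[n]$ and an edge $\{i,j\}$ ($i<j$) iff $j\le m_i$. The chromatic quasisymmetric function of a graph $G$ on $V\subset\mathbb{P}$ is $X_G(\mathbf{x},t)=\sum_\kappa t^{\mathrm{asc}(\kappa)}\prod_v x_{\kappa(v)}$ over proper colorings $\kappa:V\to\mathbb{P}$, with $\mathrm{asc}(\kappa)$ the number of edges $\{i,j\}$, $i<j$, with $\kappa(i)<\kappa(j)$. $[m]_t=1+t+\cdots+t^{m-1}$, $[m]_t!=[1]_t\cdots[m]_t$, $[0]_t!=1$; $e_\lambda$ denotes elementary symmetric functions. Writing $X_G(\mathbf{x},t)=\sum_{i=0}^m a_i(\mathbf{x})t^i$ with symmetric functions $a_i$, $X_G$ is $e$-positive if each $a_i$ is a nonnegative combination of the $e_\lambda$, and $e$-unimodal with center of symmetry $c$ if it is palindromic about $c$ ($a_i=a_{2c-i}$) and $a_{i+1}-a_i$ is $e$-positive for $0\le i<c$ (equivalently here, every coefficient of $e_\lambda$ is a unimodal polynomial with nonnegative coefficients, palindromic with center $c$). *)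

(* Defs.v *)
From HB Require Import structures.
From mathcomp Require Import all_boot all_order all_algebra.
From mathcomp Require Import mpoly.
Set Implicit Arguments. Unset Strict Implicit. Unset Printing Implicit Defensive.
Import Order.TTheory GRing.Theory Num.Theory.
Local Open Scope ring_scope.

Definition qint (m : nat) : {poly rat} := \sum_(i < m) 'X ^+ i.
Definition qfact (m : nat) : {poly rat} := \prod_(i < m) qint i.+1.

(* Incomparability graph of the natural unit interval order P(m_1,...,m_{n-1})
   on the vertex set [n] = {1,...,n} (1-indexed): for i < j,
   {i,j} is an edge iff j <= m_i. *)
Definition nuio_edge (m : nat -> nat) (i j : nat) : bool := (i < j)%N && (j <= m i)%N.

(* Vertex v : 'I_n stands for v+1 in [n]; colour c : 'I_N stands for c+1. *)
Definition proper_col (m : nat -> nat) (n N : nat) (k : {ffun 'I_n -> 'I_N}) : bool :=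
  [forall i : 'I_n, forall j : 'I_n,
     nuio_edge m i.+1 j.+1 ==> (k i != k j)].

Definition asc (m : nat -> nat) (n N : nat) (k : {ffun 'I_n -> 'I_N}) : nat :=
  #|[set ij : 'I_n * 'I_n | nuio_edge m ij.1.+1 ij.2.+1 && (k ij.1 < k ij.2)%N]|.

Definition chromX (m : nat -> nat) (n N : nat) : {mpoly {poly rat}[N]} :=
  \sum_(k : {ffun 'I_n -> 'I_N} | proper_col m k)
     ((('X : {poly rat}) ^+ asc m k)%:MP * \prod_(v : 'I_n) 'X_(k v)).

Definition e_lam (R : nzRingType) (N : nat) (lam : seq nat) : {mpoly R[N]} :=
  \prod_(k <- lam) mesym N R k.

(* A symmetric function is represented by its specializations to N variables,
   for every N. *)
Definition symfun (R : nzRingType) := forall N : nat, {mpoly R[N]}.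

Definition tcoef (X : symfun {poly rat}) (i : nat) : symfun rat :=
  fun N => map_mpoly (fun p : {poly rat} => p`_i) (X N).

Definition e_positive_sf (f : symfun rat) : Prop :=
  exists l : seq (seq nat * rat),
    (forall p, p \in l -> 0 <= p.2 /\ all (fun k => 0 < k)%N p.1) /\
    forall N, f N = \sum_(p <- l) p.2 *: e_lam rat N p.1.

Definition e_positive (X : symfun {poly rat}) : Prop :=
  forall i, e_positive_sf (tcoef X i).

(* e-unimodal with center of symmetry c = d/2 (d = 2c, a natural number):
   a_i = a_{2c-i} for all i (so a_i = 0 for i > 2c), and a_{i+1} - a_i is
   e-positive for 0 <= i < c. *)
Definition e_unimodal (X : symfun {poly rat}) (d : nat) : Prop :=
  (forall N i, (i <= d)%N -> tcoef X i N = tcoef X (d - i) N) /\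
  (forall N i, (d < i)%N -> tcoef X i N = 0) /\
  (forall i, (2 * i < d)%N -> e_positive_sf (fun N => tcoef X i.+1 N - tcoef X i N)).

(* Main.v *)
Require Import Defs.
From HB Require Import structures.
From mathcomp Require Import all_boot all_order all_algebra.
From mathcomp Require Import mpoly ring zify.
Set Implicit Arguments. Unset Strict Implicit. Unset Printing Implicit Defensive.
Import Order.TTheory GRing.Theory Num.Theory.
Local Open Scope ring_scope.

(* The vertices [2..n-1] form a clique, vertex [1] is joined to an initial
   segment of it and vertex [n] to a final segment, so a colour class has at most
   two vertices.  Removing the class of the largest colour expresses the
   chromatic function of an induced subgraph in [N+1] variables through those of
   smaller induced subgraphs in [N] variables.  Up to isomorphism an induced
   subgraph is given by the presence of [1] and [n] and by the sizes [p], [q], [u]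
   of the three blocks cut out by [s] and [r]; an explicit formula in these data
   satisfies the same recursion, because [e_j(N+1) = e_j(N) + x e_(j-1)(N)] turns
   it into polynomial identities between q-numbers.  Unimodality holds because
   each coefficient is a nonnegative combination of products of q-numbers with
   a common centre of symmetry. *)

(** * q-numbers *)

Section QNumbers.
Variables (R : comNzRingType) (t : R).
Definition qnum (m : nat) : R := \sum_(i < m) t ^+ i.
Definition qfac (m : nat) : R := \prod_(i < m) qnum i.+1.

Lemma qnum0 : qnum 0 = 0. Proof. exact: big_ord0. Qed.
Lemma qnumD m n : qnum (m + n) = qnum m + t ^+ m * qnum n.
Proof.
rewrite /qnum big_split_ord /= mulr_sumr; congr (_ + _).
by apply: eq_bigr => i _; rewrite exprD.
Qed.
Lemma qnum1 : qnum 1 = 1. Proof. by rewrite /qnum big_ord1. Qed.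
Lemma qnumS m : qnum m.+1 = 1 + t * qnum m.
Proof. by rewrite -add1n qnumD qnum1 expr1. Qed.
Lemma qnumX m : t ^+ m = 1 + (t - 1) * qnum m.
Proof. by elim: m => [|m IH]; rewrite ?qnum0 ?qnumS ?exprS ?IH ?expr0; ring. Qed.
Lemma qfac0 : qfac 0 = 1. Proof. exact: big_ord0. Qed.
Lemma qfacS m : qfac m.+1 = qfac m * qnum m.+1.
Proof. exact: big_ord_recr. Qed.
End QNumbers.

(* Since [t^m = 1 + (t - 1) [m]] and [[m + n] = [m] + t^m [n]], every identity
   between q-numbers of sums becomes a polynomial identity in [t] and the
   q-numbers of the summands. *)
Ltac qring :=
  rewrite /= ?(addSn, addnS, add0n, addn0) /= ?qfacS ?qfac0 ?qnumS ?qnumD ?qnum0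
    ?exprS ?exprD !qnumX ?qnum0 ?expr0; ring.

(** * The closed formula and its recursion on the largest colour *)

Section BlockFormula.
Variables (R : comNzRingType) (t : R).
Local Notation qnum := (qnum t).
Local Notation qfac := (qfac t).

(* The graph is a clique made of consecutive blocks of [p], [q] and [u]
   vertices, preceded (if [al]) by a vertex joined to the first two blocks and
   followed (if [be]) by a vertex joined to the last two.  The predecessors
   [k.-1], [k.-2] and [(k + q).-1] truncate only where their cofactor is [0]. *)
Definition block_formula (e : nat -> R) (al be : bool) (p q u : nat) : R :=
  let k := (p + q + u)%N in
  match al, be with
  | false, false => qfac k * e k
  | true, false => qfac k * (e k * e 1%N)
      + qfac k.-1 * qnum (p + q) * (qnum k.+1 * e k.+1 - e k * e 1%N)
  | false, true => qfac k * (e k * e 1%N)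
      + qfac k.-1 * qnum (q + u) * (qnum k.+1 * e k.+1 - e k * e 1%N)
  | true, true =>
     qfac k * (qnum k.+2 * qnum k * e k.+2 + t ^+ k * (e k.+1 * e 1%N)
       + (t ^+ (p + q) * qnum u + t ^+ (q + u) * qnum p)
         * (e k.+1 * e 1%N - qnum k.+2 * e k.+2))
     + t ^+ (k + q).-1 * qnum u * qnum p * qfac k.-2 *
        (qnum 2 * (e k * e 2%N - qnum k * (e k.+1 * e 1%N))
         + t * qnum k.-1 * qnum k.+2 * e k.+2)
  end.

(* [x] is the variable of the largest colour; its colour class is empty, a single
   vertex, or one of the non-adjacent pairs. *)
Definition block_step (x : R) (F : bool -> bool -> nat -> nat -> nat -> R)
    (al be : bool) (p q u : nat) : R :=
  F al be p q u
  + x * (qnum p * t ^+ al * F al be p.-1 q u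
         + qnum q * t ^+ (al + p) * F al be p q.-1 u
         + qnum u * t ^+ (p + q) * F al be p q u.-1)
  + (if al then x * (F false be p q u
                   + x * (qnum u * t ^+ (p + q) * F false be p q u.-1)) else 0)
  + (if be then x * t ^+ (q + u) * (F al false p q u
                                  + x * (qnum p * t ^+ al * F al false p.-1 q u)) else 0)
  + (if al && be then x ^+ 2 * t ^+ (q + u) * F false false p q u else 0).

Variables (x : R) (e e' : nat -> R).
Hypothesis (e0 : e 0%N = 1) (e'0 : e' 0%N = 1) (e'S : forall j, e' j.+1 = e j.+1 + x * e j).

(** The weights of the three blocks add up to [qnum (p + q + u)], so this is the recursion [H] of a
    single clique. *)
Lemma block_step00 p q u :
  block_step x (block_formula e) false false p q u = block_formula e' false false p q u.
Proof.
rewrite /block_step /block_formula.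
have H k : qfac k * e' k = qfac k * e k + x * (qnum k * (qfac k.-1 * e k.-1)).
  by case: k => [|k]; rewrite ?e0 ?e'0 ?qnum0 ?e'S ?qfacS /=; ring.
rewrite H !qnumD -!addnA; case: p => [|p]; case: q => [|q]; case: u => [|u];
rewrite /= ?addSn ?addnS /= ?add0n ?addn0 ?qnum0 !qnumX ?qnumD ?qnum0 ?qnumX; ring.
Qed.

(** Here and in the next two lemmas, splitting off small blocks makes every predecessor compute,
    except where its cofactor is [0]; a polynomial identity remains. *)
Lemma block_step10 p q u :
  block_step x (block_formula e) true false p q u = block_formula e' true false p q u.
Proof.
rewrite /block_step /block_formula.
case: p => [|[|p]]; case: q => [|[|q]]; case: u => [|u].
all: by rewrite /= ?(addSn, addnS, add0n, addn0) /= ?e'S ?e0 ?e'0; qring.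
Qed.

Lemma block_step01 p q u :
  block_step x (block_formula e) false true p q u = block_formula e' false true p q u.
Proof.
rewrite /block_step /block_formula.
case: p => [|p]; case: q => [|[|q]]; case: u => [|[|u]].
all: by rewrite /= ?(addSn, addnS, add0n, addn0) /= ?e'S ?e0 ?e'0; qring.
Qed.

Lemma block_step11 p q u :
  block_step x (block_formula e) true true p q u = block_formula e' true true p q u.
Proof.
rewrite /block_step /block_formula.
case: p => [|[|p]]; case: q => [|q]; case: u => [|[|u]].
all: by rewrite /= ?(addSn, addnS, add0n, addn0) /= ?e'S ?e0 ?e'0; qring.
Qed.
End BlockFormula.

(** * Colourings, one colour class at a time *)

Section ColourClasses.
Variables (R : comNzRingType) (t : R) (x : nat -> R) (T : finType) (E : rel T).

Definition indep (I : {set T}) : bool := [forall i in I, forall j in I, ~~ E i j].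

(** Reading [E i j] as an edge from [i] to [j], these edges become ascents when [I] takes a colour
    above those of [B]. *)
Definition nedges (B I : {set T}) : nat := (\sum_(i in B) \sum_(j in I) E i j)%N.

(** Colours are used from the largest down: [I] is the possibly empty class of colour [M']. *)
Fixpoint chrom_rec (M : nat) (A : {set T}) : R :=
  if M is M'.+1 then
    \sum_(I : {set T} | (I \subset A) && indep I)
      t ^+ nedges (A :\: I) I * x M' ^+ #|I| * chrom_rec M' (A :\: I)
  else (A == set0)%:R.

Definition proper_on N (A : {set T}) (k : {ffun T -> 'I_N}) : bool :=
  [forall i in A, forall j in A, E i j ==> (k i != k j)].

Definition asc_on N (A : {set T}) (k : {ffun T -> 'I_N}) : nat :=
  (\sum_(i in A) \sum_(j in A) (E i j && (k i < k j)%N))%N.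

(** As [M] bounds all colours, no ascent starts in [I], and every edge from outside into [I] is
    one. *)
Lemma asc_on_split N M (A : {set T}) (k : {ffun T -> 'I_N})
    (I := [set v in A | k v == M :> nat]) :
  {in A, forall v, (k v <= M)%N} ->
  asc_on A k = (nedges (A :\: I) I + asc_on (A :\: I) k)%N.
Proof.
move=> kM; rewrite /asc_on /nedges.
rewrite (big_setID I) /= [X in (X + _)%N]big1 ?add0n; last first.
  move=> i; rewrite !inE => /andP[_ /andP[_ /eqP ki]].
  by apply: big1 => j /kM kj; rewrite ki ltnNge kj andbF.
rewrite -big_split /=; apply: eq_bigr => i; rewrite !inE => /andP[iI iA].
have IA : I \subset A by apply/subsetP => v; rewrite inE => /andP[].
rewrite (big_setID I) /= (setIidPr IA); congr (_ + _)%N.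
apply: eq_bigr => j; rewrite inE => /andP[_ /eqP ->].
move: iI (kM _ iA); rewrite iA /= => kne kle.
by rewrite ltn_neqAle kne kle !andbT.
Qed.

(** Vertices of equal colour lie both in [I] or both outside it. *)
Lemma proper_on_split N M (A : {set T}) (k : {ffun T -> 'I_N})
    (I := [set v in A | k v == M :> nat]) :
  proper_on A k = indep I && proper_on (A :\: I) k.
Proof.
have kE v : v \in A -> (v \in I) = (k v == M :> nat) by rewrite inE => ->.
have IA v : v \in I -> v \in A by rewrite inE => /andP[].
apply/'forall_in_forall_inP/andP => [H|[/'forall_in_forall_inP H1 /'forall_in_forall_inP H2]].
  split; apply/'forall_in_forall_inP => i iI j jI.
    apply/negP => Eij.
    have := H _ (IA _ iI) _ (IA _ jI); rewrite Eij /= -val_eqE /=.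
    by move: (iI) (jI); rewrite !kE ?IA // => /eqP -> /eqP ->; rewrite eqxx.
  by move: iI jI; rewrite !in_setD => /andP[_ iA] /andP[_ jA]; apply: H.
move=> i iA j jA; apply/implyP => Eij; apply/negP => /eqP kij.
case iI: (i \in I).
  have jI : j \in I by rewrite kE // -kij -kE.
  by have := H1 _ iI _ jI; rewrite Eij.
have jI : j \in I = false by rewrite kE // -kij -kE.
have := H2 i; rewrite in_setD iI iA => /(_ isT j).
by rewrite in_setD jI jA Eij kij eqxx => /(_ isT).
Qed.

(** A colouring of [A] is encoded as one of all of [T] that agrees with [k0] outside [A], so the
    type of colourings stays fixed while the induction shrinks [A]. *)
Lemma sum_colourings N M (A : {set T}) (k0 : {ffun T -> 'I_N}) : (M <= N)%N ->
  \sum_(k : {ffun T -> 'I_N} |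
      [forall v, if v \in A then (k v < M)%N else k v == k0 v] && proper_on A k)
    t ^+ asc_on A k * \prod_(v in A) x (k v) = chrom_rec M A.
Proof.
elim: M A k0 => [|M IH] A k0 MN /=.
  have [->|[v vA]] := set_0Vmem A.
    rewrite eqxx (big_pred1 k0) => [|k]; first by rewrite /asc_on !big_set0 mulr1.
    have -> : proper_on set0 k by apply/'forall_in_forall_inP => i; rewrite inE.
    rewrite andbT; apply/forallP/eqP => [H|-> v]; last by rewrite inE.
    by apply/ffunP => v; have := H v; rewrite inE => /eqP.
  rewrite big_pred0 => [|k].
    by case: eqP vA => [->|]; rewrite ?inE.
  by apply/negP => /andP[/forallP/(_ v)]; rewrite vA.
pose I_ (k : {ffun T -> 'I_N}) := [set v in A | k v == M :> nat].
rewrite (partition_big I_ (fun I : {set T} => (I \subset A) && indep I)) /=; last first.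
  move=> k /andP[_]; rewrite (proper_on_split M) -/(I_ k) => /andP[-> _].
  by rewrite andbT; apply/subsetP => v; rewrite inE => /andP[].
apply: eq_bigr => I /andP[/subsetP IA indI].
(* Freezing the vertices of [I] at colour [M] turns the fibre over [I] into the index set of the
   induction hypothesis. *)
pose k1 := [ffun v => if v \in I then Ordinal MN else k0 v].
rewrite -(IH _ k1) ?(ltnW MN) // mulr_sumr.
have fibE (k : {ffun T -> 'I_N}) :
    [&& [forall v, if v \in A then (k v < M.+1)%N else k v == k0 v],
        proper_on A k & I_ k == I]
   = [forall v, if v \in A :\: I then (k v < M)%N else k v == k1 v] && proper_on (A :\: I) k.
  apply/and3P/andP => [[/forallP H pr /eqP IE]|[/forallP H pr]].
    move: pr; rewrite (proper_on_split M) -/(I_ k) IE => /andP[_ pr]; split=> //.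
    apply/forallP => v; move: (H v); rewrite in_setD ffunE.
    case vI: (v \in I) => /=.
      by move: vI; rewrite -{1}IE inE => /andP[_ /eqP kv] _; rewrite -val_eqE /= kv.
    case: ifP => // vA; move: vI; rewrite -IE inE vA /= => kne.
    by rewrite ltnS leq_eqVlt kne.
  have IE : I_ k = I.
    apply/setP => v; move: (H v); rewrite in_setD ffunE inE.
    case vI: (v \in I) => /=; first by rewrite (IA _ vI) => /eqP ->; rewrite eqxx.
    by case: (v \in A) => //= kv; rewrite ltn_eqF.
  split; last exact/eqP.
    apply/forallP => v; move: (H v); rewrite in_setD ffunE.
    case vI: (v \in I) => /=; first by rewrite (IA _ vI) => /eqP ->.
    by case: (v \in A) => //= kv; rewrite ltnW.
  by rewrite (proper_on_split M) -/(I_ k) IE indI.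
apply: eq_big => k; first by rewrite -andbA fibE.
rewrite -andbA => /and3P[/forallP H _ /eqP IE].
have kM : {in A, forall v, (k v <= M)%N} by move=> v vA; have := H v; rewrite vA.
rewrite (asc_on_split kM) -/(I_ k) IE exprD (big_setID I) /=.
have -> : A :&: I = I by apply/setIidPr/subsetP.
rewrite (eq_bigr (fun=> x M)) => [|v]; last by rewrite -IE inE => /andP[_ /eqP ->].
by rewrite prodr_const; ring.
Qed.
End ColourClasses.

(** * Graphs made of ordered clique blocks *)

Lemma sum_set1 (V : nmodType) (T : finType) (A : {set T}) (G : {set T} -> V) :
  \sum_(I : {set T} | (I \subset A) && (#|I| == 1%N)) G I = \sum_(v in A) G [set v].
Proof.
rewrite -(big_imset (h := set1) G) /=; last by move=> v w _ _; apply: set1_inj.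
apply: eq_bigl => I; apply/andP/imsetP => [[IA /cards1P[v Iv]]|[v vA ->]].
  by exists v => //; rewrite Iv sub1set in IA.
by rewrite sub1set vA cards1.
Qed.

Lemma sum_set2 (V : nmodType) n (A : {set 'I_n}) (G : {set 'I_n} -> V) :
  \sum_(I : {set 'I_n} | (I \subset A) && (#|I| == 2)) G I =
  \sum_(v in A) \sum_(w in A | (v < w)%N) G [set v; w].
Proof.
rewrite pair_big_dep /=.
pose S := [set vw : 'I_n * 'I_n | [&& vw.1 \in A, vw.2 \in A & (vw.1 < vw.2)%N]].
transitivity (\sum_(vw in S) G [set vw.1; vw.2]); last first.
  by apply: eq_bigl => vw; rewrite inE.
rewrite -(big_imset (h := fun vw => [set vw.1; vw.2]) G) /=; last first.
  move=> [v w] [v' w'] /=; rewrite !inE /= => /and3P[_ _ vw] /and3P[_ _ vw'] /setP eq2.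
  have := eq2 v; have := eq2 w; have := eq2 v'; have := eq2 w'.
  rewrite !inE !eqxx /= !orbT.
  case: (w' =P v) => [w'v|_] /=.
    move=> _; case: (v' =P v) => [v'v|_] /=; first by rewrite v'v w'v ltnn in vw'.
    by move=> /eqP v'w; move: vw'; rewrite v'w w'v ltnNge ltnW.
  move=> /eqP w'w; case: (v' =P v) => [v'v|_] /=; first by rewrite v'v w'w.
  by move=> /eqP v'w; rewrite v'w w'w ltnn in vw'.
apply: eq_bigl => I; apply/andP/imsetP => [[IA /cards2P[v [w [vw Iv]]]]|[[v w]]].
  move: IA; rewrite Iv subUset !sub1set => /andP[vA wA].
  case: (ltngtP v w) => [lt|gt|/val_inj eq]; last by rewrite eq eqxx in vw.
    by exists (v, w); rewrite // inE /= vA wA.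
  by exists (w, v); rewrite /= 1?setUC // inE /= vA wA.
rewrite inE /= => /and3P[vA wA vw] ->; rewrite subUset !sub1set vA wA cards2.
by rewrite -val_eqE /= neq_ltn vw.
Qed.

(** The ranks in [B] are [0, ..., #|B| - 1]; the induction removes the largest element. *)
Lemma sum_rank (R : comNzRingType) (t : R) n (B : {set 'I_n}) :
  \sum_(v in B) t ^+ #|[set w in B | (w < v)%N]| = qnum t #|B|.
Proof.
move: {2}#|B| (erefl #|B|) => k; elim: k B => [|k IH] B kB.
  by rewrite kB qnum0 (cards0_eq kB) big_set0.
have /card_gt0P[v0 v0B] : (0 < #|B|)%N by rewrite kB.
case: (arg_maxnP (fun v : 'I_n => v : nat) v0B) => v vB0 vmax0.
have [vB vmax] : v \in B /\ {in B, forall w : 'I_n, (w <= v)%N} by [].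
have kB' : #|B :\ v| = k by move: kB; rewrite (cardsD1 v) vB => -[].
rewrite kB (big_setD1 v) //= -[in RHS]addn1 qnumD qnum1 mulr1 addrC -kB' -IH ?kB' //.
congr (_ + t ^+ _).
  apply: eq_bigr => w; rewrite !inE => /andP[wv wB]; congr (t ^+ #|pred_of_set _|).
  apply/setP => z; rewrite !inE; case: eqVneq => //= ->.
  by rewrite vB ltnNge vmax.
rewrite -kB'; apply: eq_card => z; rewrite !inE andbC.
case zB: (z \in B); rewrite ?andbF ?andbT //.
by rewrite ltn_neqAle (vmax _ zB) andbT.
Qed.

(* The vertices are split into consecutive cliques, the zones; two vertices in
   different zones are adjacent unless their zones are related by [excl]. *)
Section Zones.
Variables (R : comNzRingType) (t : R) (x : nat -> R) (n : nat) (E : rel 'I_n).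
Variables (zone : 'I_n -> nat) (excl : rel nat) (nz : nat).
Hypothesis zone_lt : forall v, (zone v < nz)%N.
Hypothesis zone_mono : forall v w, (zone v < zone w)%N -> (v < w)%N.
Hypothesis edgeE : forall v w, E v w = (v < w)%N && ~~ excl (zone v) (zone w).
Hypothesis excl_lt : forall a b, excl a b -> (a < b)%N.
Hypothesis excl_tri : forall a b c, excl a b -> ~~ excl b c.

Definition cnt (A : {set 'I_n}) (z : nat) := #|[set v in A | zone v == z]|.
(** The number of edges that a vertex of zone [b] receives from earlier zones when each zone [a]
    holds [c a] vertices. *)
Definition lowdeg (c : nat -> nat) (b : nat) :=
  (\sum_(a < nz | (a < b)%N && ~~ excl a b) c a)%N.

Lemma sum_zone (V : nmodType) (A : {set 'I_n}) (h : 'I_n -> V) :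
  \sum_(v in A) h v = \sum_(z < nz) \sum_(v in [set v in A | zone v == z]) h v.
Proof.
rewrite (partition_big (fun v => Ordinal (zone_lt v)) xpredT) //=.
by apply: eq_bigr => z _; apply: eq_bigl => v; rewrite -val_eqE /= inE.
Qed.

(** Edges into [v] come from the smaller vertices of its own zone, a clique, and from all vertices
    of the earlier zones that are not excluded. *)
Lemma degE (A : {set 'I_n}) v : v \in A ->
  (\sum_(i in A) E i v =
   #|[set w in [set w in A | zone w == zone v] | (w < v)%N]| + lowdeg (cnt A) (zone v))%N.
Proof.
move=> vA; rewrite sum_zone (bigD1 (Ordinal (zone_lt v))) //=; congr (_ + _)%N.
  rewrite -sum1_card [RHS]big_mkcond [LHS]big_mkcond /=.
  apply: eq_bigr => i _; rewrite !inE; case: (i \in A) => //=.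
  case: eqP => //= zi; rewrite edgeE zi; case: (i < v)%N => //=.
  case ex: (excl _ _) => //; by have := excl_lt ex; rewrite ltnn.
rewrite /lowdeg [RHS]big_mkcond [LHS]big_mkcond /=; apply: eq_bigr => z _.
rewrite -val_eqE /= /cnt -sum1_card.
case: (ltngtP z (zone v)) => zv /=; last by [].
- case: ifP => ex; last first.
    apply: big1 => i; rewrite inE => /andP[_ /eqP zi].
    by rewrite edgeE zi ex andbF.
  apply: eq_bigr => i; rewrite inE => /andP[_ /eqP zi].
  by rewrite edgeE zi ex andbT zone_mono // zi.
- apply: big1 => i; rewrite inE => /andP[_ /eqP zi].
  by rewrite edgeE ltnNge ltnW // zone_mono // zi.
Qed.

Lemma cntD1 (A : {set 'I_n}) v z : v \in A -> cnt (A :\ v) z = (cnt A z - (z == zone v))%N.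
Proof.
move=> vA; rewrite /cnt [in RHS](cardsD1 v) inE vA /= [zone v == z]eq_sym addKn.
by apply: eq_card => w; rewrite !inE andbA.
Qed.

(** Three independent vertices [u < v < w] would give two consecutive exclusions, against
    [excl_tri]; [mid] is instantiated for each of the six orders. *)
Lemma indep_card_le2 (I : {set 'I_n}) : indep E I -> (#|I| <= 2)%N.
Proof.
move=> /'forall_in_forall_inP ind; rewrite leqNgt; apply/negP => I3.
have lt v w : v \in I -> w \in I -> (v < w)%N -> excl (zone v) (zone w).
  by move=> vI wI vw; have := ind _ vI _ wI; rewrite edgeE vw /= negbK.
have mid u v w : u \in I -> v \in I -> w \in I -> (u < v)%N -> (v < w)%N -> False.
  by move=> uI vI wI uv vw; have := excl_tri (zone w) (lt _ _ uI vI uv); rewrite lt.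
move: I3; rewrite cardE => I3.
have := enum_uniq I; have inI v : v \in enum I -> v \in I by rewrite mem_enum.
case: (enum I) I3 inI => [|a [|b [|c s]]] //= _ inI.
have [aI bI cI] : [/\ a \in I, b \in I & c \in I].
  by split; apply: inI; rewrite !inE eqxx ?orbT.
rewrite !inE !negb_or -!andbA -!val_eqE => /and5P[ab ac _ bc _].
have [m1 m2] := (mid a b c aI bI cI, mid a c b aI cI bI).
have [m3 m4] := (mid b a c bI aI cI, mid b c a bI cI aI).
have [m5 m6] := (mid c a b cI aI bI, mid c b a cI bI aI).
move: ab ac bc; case: (ltngtP a b) => // ? _; case: (ltngtP a c) => // ? _.
all: case: (ltngtP b c) => // ? _; auto.
Qed.

Lemma indepE (I : {set 'I_n}) :
  indep E I = [forall v in I, forall w in I, (v < w)%N ==> excl (zone v) (zone w)].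
Proof.
apply: eq_forallb => v; congr (_ ==> _); apply: eq_forallb => w; congr (_ ==> _).
by rewrite edgeE negb_and negbK implybE.
Qed.

Lemma indep_set0 : indep E set0.
Proof. by apply/'forall_in_forall_inP => v; rewrite inE. Qed.

Lemma indep_set1 v : indep E [set v].
Proof. by apply/'forall_in_forall_inP => i /set1P-> j /set1P->; rewrite edgeE ltnn. Qed.

Lemma indep_set2 (v w : 'I_n) : (v < w)%N -> indep E [set v; w] = excl (zone v) (zone w).
Proof.
move=> vw; rewrite indepE; apply/'forall_in_forall_inP/idP => [H|ex i /set2P ii j /set2P jj].
  by have := H v (set21 v w) w (set22 v w); rewrite vw.
case: ii jj => -> [] ->; rewrite ?ltnn ?vw ?ex //.
by rewrite ltnNge ltnW.
Qed.

Lemma sum_indep (V : nmodType) (A : {set 'I_n}) (G : {set 'I_n} -> V) :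
  \sum_(I : {set 'I_n} | (I \subset A) && indep E I) G I =
  G set0 + \sum_(v in A) G [set v]
  + \sum_(v in A) \sum_(w in A | excl (zone v) (zone w)) G [set v; w].
Proof.
rewrite (bigD1 set0) ?sub0set ?indep_set0 //= -addrA; congr (_ + _).
rewrite (bigID (fun I : {set 'I_n} => #|I| == 1%N)) /=; congr (_ + _).
  rewrite -sum_set1; apply: eq_bigl => I.
  case: (boolP (#|I| == 1%N)) => [/cards1P[v ->]|]; rewrite ?andbF //.
  rewrite indep_set1 !andbT; case: eqP => [/setP/(_ v)|]; last by rewrite andbT.
  by rewrite !inE eqxx.
transitivity (\sum_(I : {set 'I_n} | (I \subset A) && (#|I| == 2)) (if indep E I then G I else 0)).
  rewrite -big_mkcondr /=; apply: eq_bigl => I.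
  case: (I \subset A) => //=; case ind: (indep E I); rewrite ?andbF ?andbT //=.
  move: (indep_card_le2 ind); rewrite -cards_eq0.
  by case: #|I| => [|[|[|]]].
rewrite sum_set2; apply: eq_bigr => v vA.
rewrite [RHS]big_mkcondr [LHS]big_mkcondr; apply: eq_bigr => w wA.
case: ifP => [vw|nvw]; first by rewrite indep_set2.
case ex: (excl _ _) => //.
by rewrite zone_mono // in nvw; apply: excl_lt.
Qed.

(** Edges inside [I] are absent, so in-degrees may be computed in all of [A], where [degE] gives
    them. *)
Lemma nedges_indep (A I : {set 'I_n}) : I \subset A -> indep E I ->
  nedges E (A :\: I) I = (\sum_(j in I) \sum_(i in A) E i j)%N.
Proof.
move=> IA /'forall_in_forall_inP ind; rewrite /nedges exchange_big /=.
apply: eq_bigr => j jI; rewrite [RHS](big_setID I) /= [X in _ = (X + _)%N]big1 //.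
by move=> i /setIP[_ iI]; apply/eqP; rewrite eqb0 ind.
Qed.

(** If the value for [M] colours depends only on zone sizes, so does the next one: the ranks of a
    removed vertex inside its zone sum to a q-number by [sum_rank], and the other factors are
    constant on zones. *)
Lemma chrom_rec_step M (A : {set 'I_n}) (f : (nat -> nat) -> R) (c := cnt A) :
  (forall c1 c2, (forall z, (z < nz)%N -> c1 z = c2 z) -> f c1 = f c2) ->
  (forall B, chrom_rec t x E M B = f (cnt B)) ->
  chrom_rec t x E M.+1 A =
    f c
    + x M * \sum_(a < nz) qnum t (c a) * t ^+ lowdeg c a * f (fun z => c z - (z == a))%N
    + x M ^+ 2 * \sum_(a < nz) \sum_(b < nz | excl a b)
        qnum t (c a) * qnum t (c b) * t ^+ (lowdeg c a + lowdeg c b)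
        * f (fun z => c z - (z == a) - (z == b))%N.
Proof.
move=> fext IH /=; rewrite sum_indep; congr (_ + _ + _).
- by rewrite setD0 /nedges big1 ?cards0 ?mul1r ?IH // => i _; rewrite big_set0.
- rewrite sum_zone mulr_sumr; apply: eq_bigr => a _.
  transitivity (\sum_(v in [set v in A | zone v == a])
      t ^+ #|[set w in [set w in A | zone w == a] | (w < v)%N]|
      * (x M * t ^+ lowdeg c a * f (fun z => c z - (z == a))%N)); last first.
    by rewrite -mulr_suml sum_rank -/(cnt A a) -/(c a); ring.
  apply: eq_bigr => v; rewrite inE => /andP[vA /eqP za].
  rewrite nedges_indep ?sub1set ?indep_set1 // big_set1 degE // za cards1 IH exprD.
  rewrite (fext _ (fun z => c z - (z == a))%N); first by ring.
  by move=> z _; rewrite cntD1 // za.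
- rewrite sum_zone mulr_sumr; apply: eq_bigr => a _.
  rewrite mulr_sumr.
  transitivity (\sum_(v in [set v in A | zone v == a]) \sum_(b < nz | excl a b)

      t ^+ #|[set w in [set w in A | zone w == a] | (w < v)%N]|
      * (x M ^+ 2 * qnum t (c b) * t ^+ (lowdeg c a + lowdeg c b)
         * f (fun z => c z - (z == a) - (z == b))%N)); last first.
    rewrite exchange_big; apply: eq_bigr => b _ /=.
    by rewrite -mulr_suml sum_rank -/(cnt A a) -/(c a); ring.
  apply: eq_bigr => v; rewrite inE => /andP[vA /eqP za].
  rewrite big_mkcondr sum_zone [RHS]big_mkcond; apply: eq_bigr => b _ /=; rewrite -big_mkcondr za.
  case: ifP => ab; last first.
    by apply: big1 => w; rewrite inE => /andP[/andP[_ /eqP ->]]; rewrite ab.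
  transitivity (\sum_(w in [set w in A | zone w == b])
      t ^+ #|[set w' in [set w in A | zone w == b] | (w' < w)%N]|
      * (t ^+ #|[set w in [set w in A | zone w == a] | (w < v)%N]|
         * x M ^+ 2 * t ^+ (lowdeg c a + lowdeg c b)
         * f (fun z => c z - (z == a) - (z == b))%N)); last first.
    by rewrite -mulr_suml sum_rank -/(cnt A b) -/(c b); ring.
  apply: eq_big => w.
    by rewrite inE; case: eqP => [->|]; rewrite ?ab ?andbT ?andbF.
  rewrite inE => /andP[/andP[wA /eqP zb] _].
  have vw : (v < w)%N by apply: zone_mono; rewrite za zb excl_lt.
  have nvw : v != w by rewrite -val_eqE /= ltn_eqF.
  rewrite nedges_indep ?indep_set2 ?za ?zb ?subUset ?sub1set ?vA ?wA //.
  rewrite big_setU1 ?inE //= big_set1 !degE // za zb cards2 nvw IH.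
  rewrite (fext _ (fun z => c z - (z == a) - (z == b))%N); first by rewrite !exprD; ring.
  move=> z _; rewrite setUC -setDDl setDDl setUC -setDDl !cntD1 ?za ?zb //.
  by rewrite !inE wA eq_sym nvw.
Qed.
End Zones.

(** * The natural unit interval order of the theorem *)

(* [v] is 0-indexed: zone [0] is the vertex [1] of the order, zones [1], [2], [3]
   are [2..s], [s+1..r], [r+1..n-1], and zone [4] is [n]. *)
Definition zone (n r s v : nat) : nat :=
  (if v == 0 then 0 else if v < s then 1 else if v < r then 2
  else if v < n.-1 then 3 else 4)%N.

Definition excl (a b : nat) : bool :=
  [|| (a == 0) && (b == 3), (a == 0) && (b == 4) | (a == 1) && (b == 4)]%N.

Section RecStep.
Variables (R : comNzRingType) (t : R).

(** Zones [0] and [4] hold at most one vertex, so their sizes act as booleans and their q-numbers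
    are [0] or [1]. *)
Lemma block_stepE (x : R) (F : bool -> bool -> nat -> nat -> nat -> R) (c : nat -> nat)
    (f := fun c : nat -> nat => F (0 < c 0%N)%N (0 < c 4%N)%N (c 1%N) (c 2%N) (c 3%N)) :
  (c 0%N <= 1)%N -> (c 4%N <= 1)%N ->
  f c
  + x * \sum_(a < 5) qnum t (c a) * t ^+ lowdeg excl 5 c a * f (fun z => c z - (z == a))%N
  + x ^+ 2 * \sum_(a < 5) \sum_(b < 5 | excl a b)
      qnum t (c a) * qnum t (c b) * t ^+ (lowdeg excl 5 c a + lowdeg excl 5 c b)
      * f (fun z => c z - (z == a) - (z == b))%N
  = block_step t x F (0 < c 0%N)%N (0 < c 4%N)%N (c 1%N) (c 2%N) (c 3%N).
Proof.
move=> c0 c4; rewrite {}/f.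
have bE := (erefl : bump 0 0 = 1%N, erefl : bump 0 1 = 2%N,
  erefl : bump 0 2 = 3%N, erefl : bump 0 3 = 4%N).
have ldE a : lowdeg excl 5 c a = (if a is 0 then 0 else if a is 1 then c 0%N else
    if a is 2 then c 0%N + c 1%N else if a is 3 then c 1%N + c 2%N else
    if a is 4 then c 2%N + c 3%N else lowdeg excl 5 c a)%N.
  case: a => [|[|[|[|[|a]]]]] //; rewrite /lowdeg big_mkcond !big_ord_recl big_ord0 /= ?bE; lia.
under [X in _ + _ * X = _]eq_bigr => a _ do rewrite big_mkcond !big_ord_recl big_ord0.
rewrite !big_ord_recl !big_ord0 /= !bE /= !ldE /= !subn0 !subn1 /block_step.
case: (c 0%N) c0 => [|[|//]] _; case: (c 4%N) c4 => [|[|//]] _ /=; rewrite ?qnum0 ?qnum1 !exprD; ring.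
Qed.
End RecStep.

Section NUIO.
Variables (n r s : nat) (m : nat -> nat).
Hypotheses (hs : (2 <= s)%N) (hsr : (s <= r)%N) (hrn : (r + 2 <= n)%N)
  (hm1 : m 1%N = r)
  (hm2 : forall i, (2 <= i <= s)%N -> m i = (n - 1)%N)
  (hm3 : forall i, (s + 1 <= i <= n - 1)%N -> m i = n).

Lemma zone_mono (v w : 'I_n) : (zone n r s v < zone n r s w)%N -> (v < w)%N.
Proof. by case: v w => v vn [w wn]; rewrite /zone /=; do ! case: ifP => /= ?; lia. Qed.

Lemma nuio_edge_zone (v w : 'I_n) : nuio_edge m v.+1 w.+1 =
  (v < w)%N && ~~ excl (zone n r s v) (zone n r s w).
Proof.
case: v w => v vn [w wn]; rewrite /nuio_edge /=.
case: (ltnP v w) => vw; last by rewrite ltnNge ltnS vw.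
rewrite ltnS vw /=.
(* [v] stands for the vertex [v + 1], hence [v < s]; the last vertex has no [m], but [v < w] rules
   it out. *)
have mE : m v.+1 = (if v == 0 then r else if v < s then n - 1 else n)%N.
  case: eqP => [->|v0] //; case: ltnP => vs; [apply: hm2|apply: hm3]; lia.
by rewrite mE /zone /=; do ! case: ifP => /= ?; lia.
Qed.

Variables (R : comNzRingType) (t : R) (x : nat -> R) (e : nat -> nat -> R).
Hypotheses (e0 : forall j, e 0%N j = (j == 0%N)%:R) (eM0 : forall M, e M 0%N = 1)
  (eS : forall M j, e M.+1 j.+1 = e M j.+1 + x M * e M j).

Lemma cnt_le1 (A : {set 'I_n}) z : z \in [:: 0%N; 4%N] -> (cnt (zone n r s) A z <= 1)%N.
Proof.
move=> z04; apply/card_le1_eqP => v w; rewrite !inE => /andP[_ /eqP zv] /andP[_ /eqP zw].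
apply/val_inj; case: v w zv zw => v vn [w wn] /=.
by move: z04; rewrite /zone !inE => /orP[] /eqP ->; do ! case: ifP => /= ?; lia.
Qed.

Lemma chrom_rec_block_formula M (A : {set 'I_n}) (c := cnt (zone n r s) A) :
  chrom_rec t x (fun v w : 'I_n => nuio_edge m v.+1 w.+1) M A =
  block_formula t (e M) (0 < c 0%N)%N (0 < c 4%N)%N (c 1%N) (c 2%N) (c 3%N).
Proof.
rewrite {}/c; elim: M A => [|M IH] A.
  (* Without variables [e 0 j] vanishes for [j > 0]: the formula is [1] on the empty set, and
     otherwise each of its terms contains such a factor. *)
  rewrite /=; have [->|[v vA]] := set_0Vmem A.
    have c0 z : cnt (zone n r s) set0 z = 0%N.
      by apply/eqP; rewrite cards_eq0; apply/eqP/setP => v; rewrite !inE.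
    by rewrite !c0 eqxx /= e0 qfac0 mulr1.
  have : (0 < cnt (zone n r s) A (zone n r s v))%N by apply/card_gt0P; exists v; rewrite inE vA /=.
  have -> : (A == set0) = false by apply/negbTE/set0Pn; exists v.
  move: (cnt _ _) => c; have : (zone n r s v < 5)%N.
    by rewrite /zone; do ! case: ifP => /= ?.
  rewrite /block_formula !e0; move: (zone _ _ _ _) => z z5 cz.
  case: (posnP (c 0%N)) => c0; case: (posnP (c 4%N)) => c4 /=; rewrite ?e0 ?(mulr0, mul0r, addr0, subr0) //.
  case: eqP => [k0|]; last by rewrite mulr0.
  by case: z z5 cz => [|[|[|[|[|]]]]] // _; lia.
pose f (c : nat -> nat) := block_formula t (e M) (0 < c 0%N)%N (0 < c 4%N)%N (c 1%N) (c 2%N) (c 3%N).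
rewrite (@chrom_rec_step _ t x _ _ (fun v => zone n r s v) excl 5 _ _ _ _ _ M A f) /=.
- rewrite block_stepE ?cnt_le1 ?inE //.
  have [[h1 h2] h3] := (eM0 M, eM0 M.+1, eS M).
  case: (0 < _)%N; case: (0 < _)%N.
  + exact: block_step11.
  + exact: block_step10.
  + exact: block_step01.
  + exact: block_step00.
- by move=> v; rewrite /zone; do ! case: ifP => /= ?.
- exact: zone_mono.
- exact: nuio_edge_zone.
- by move=> a b; rewrite /excl; lia.
- by move=> a b d; rewrite /excl; lia.
- by move=> c1 c2 c12; rewrite /f !c12.
- exact: IH.
Qed.
End NUIO.

(** * The expansion in elementary symmetric functions *)

Section Esym.
Variables (R : comNzRingType) (x : nat -> R).
(** The generating product makes the recursion in the number of variables immediate. *)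
Definition esym (M j : nat) : R := (\prod_(i < M) (1 + x i *: 'X))`_j.

Lemma esym_0 j : esym 0 j = (j == 0%N)%:R.
Proof. by rewrite /esym big_ord0 coef1. Qed.

Lemma esym_S M j : esym M.+1 j = esym M j + (if j is j'.+1 then x M * esym M j' else 0).
Proof.
rewrite /esym big_ord_recr /= mulrDr mulr1 coefD -scalerAr coefZ coefMX.
by case: j => [|j]; rewrite ?mulr0.
Qed.

Lemma esym_M0 M : esym M 0 = 1.
Proof. by elim: M => [|M IH]; rewrite ?esym_0 // esym_S IH addr0. Qed.

Lemma esymE N j : esym N j = \sum_(h : {set 'I_N} | #|h| == j) \prod_(i in h) x i.
Proof.
rewrite /esym; under eq_bigr do rewrite addrC.
rewrite bigA_distr coef_sum [RHS]big_mkcond; apply: eq_bigr => h _ /=.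
rewrite -big_mkcond /= scaler_prod prodr_const coefZ coefXn eq_sym.
by case: eqP; rewrite ?mulr1 ?mulr0.
Qed.
End Esym.

(** With [nat] indices, each intermediate number of colours takes an initial segment of one
    sequence; [0] is the default from [N] on. *)
Definition mvar (R : nzRingType) (N i : nat) : {mpoly R[N]} :=
  oapp (fun j : 'I_N => 'X_j) 0 (insub i).

Lemma mvarE (R : nzRingType) N (i : 'I_N) : mvar R N i = 'X_i.
Proof. by rewrite /mvar valK. Qed.

Lemma mesym_esym (R : comNzRingType) N j : mesym N R j = esym (mvar R N) N j.
Proof.
rewrite esymE; apply: eq_bigr => h _; apply: eq_bigr => i _; by rewrite mvarE.
Qed.

Lemma card_ord_itv n a b : (b <= n)%N -> #|[set v : 'I_n | (a <= v < b)%N]| = (b - a)%N.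
Proof.
move=> bn; rewrite -sum1_card; under eq_bigl => v do rewrite inE.
rewrite -(big_mkord (fun i => a <= i < b)%N (fun=> 1%N)) /=.
rewrite -[RHS]muln1 -sum_nat_const_nat (big_nat_widen _ _ _ _ _ bn).
rewrite [RHS](big_nat_widenl _ 0) //.
by apply: eq_bigl => i /=; rewrite andbC.
Qed.

Lemma chromX_chrom_rec m n N : (0 < n)%N ->
  chromX m n N = chrom_rec ('X%:MP) (mvar {poly rat} N)
    (fun v w : 'I_n => nuio_edge m v.+1 w.+1) N setT.
Proof.
(* With no colours there is no [k0] for [sum_colourings]; both sides are [0] because [n > 0]. *)
move=> n0; case: N => [|N].
  rewrite /chromX big_pred0 => [|k]; last by case: (k (Ordinal n0)).
  by rewrite /=; case: eqP => // /setP/(_ (Ordinal n0)); rewrite !inE.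
rewrite -(@sum_colourings _ _ _ _ _ N.+1 N.+1 setT [ffun=> ord0]) //; apply: eq_big => k.
  have -> : [forall v, if v \in setT then (k v < N.+1)%N else k v == [ffun=> ord0] v].
    by apply/forallP => v; rewrite inE ltn_ord.
  apply: eq_forallb => i; rewrite inE; apply: eq_forallb => j; by rewrite inE.
move=> _; rewrite rmorphXn /=; congr (_ ^+ _ * _).
  rewrite /asc /asc_on -sum1_card big_mkcond /=.
  rewrite [RHS](eq_bigr (fun i : 'I_n => \sum_(j : 'I_n) (nuio_edge m i.+1 j.+1 && (k i < k j))))%N; last first.
    by move=> i _; apply: eq_bigl => j; rewrite inE.
  rewrite [RHS](eq_bigl xpredT) => [|i]; last by rewrite inE.
  by rewrite pair_big /=; apply: eq_bigr => ij _; rewrite inE; case: (_ && _).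
by apply: eq_big => v; rewrite ?inE // mvarE.
Qed.

(** In the theorem [k = n - 2], [a = r - 1] and [b = n - s - 1]; the terms are collected by the
    three products of elementary symmetric functions. *)
Lemma block_formula11E (R : comNzRingType) (t : R) (e : nat -> R) p q u
    (k := (p + q + u).+2) (a := (p + q).+1) (b := (q + u).+1) :
  block_formula t e true true p.+1 q u.+1 = qfac t (p + q + u) * (
     (qnum t k.+2 * qnum t k.-1 * qnum t a * qnum t b) * e k.+2
     + (qnum t k * (t ^+ k * qnum t k.-1 + qnum t k.-1 * (t ^+ a * qnum t u.+1 + t ^+ b * qnum t p.+1)
         - qnum t 2 * t ^+ (a + b).-1 * qnum t u.+1 * qnum t p.+1)) * (e k.+1 * e 1%N)
     + (t ^+ (a + b).-1 * qnum t 2 * qnum t u.+1 * qnum t p.+1) * (e k * e 2%N)).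
Proof.
by rewrite {}/k {}/a {}/b /block_formula; qring.
Qed.

(** The coefficient [c] found by the recursion contains a subtraction. Its double has the
    subtraction-free form of the theorem, hence the factor one half there. *)
Lemma double_C1 (R : comNzRingType) (t : R) p q u
    (k := (p + q + u).+2) (a := (p + q).+1) (b := (q + u).+1)
    (c := qnum t k * (t ^+ k * qnum t k.-1 + qnum t k.-1 * (t ^+ a * qnum t u.+1 + t ^+ b * qnum t p.+1)
         - qnum t 2 * t ^+ (a + b).-1 * qnum t u.+1 * qnum t p.+1)) :
  qnum t k * ((t ^+ a + t ^+ b) * qnum t k.-1 + t ^+ b * qnum t 2 * qnum t a.-1 * qnum t p.+1
            + t ^+ a * qnum t 2 * qnum t u.+1 * qnum t b.-1) = c *+ 2.
Proof.
by rewrite {}/c {}/k {}/a {}/b; qring.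
Qed.

Lemma qnum_mpolyC N m : qnum ('X%:MP : {mpoly {poly rat}[N]}) m = (qint m)%:MP.
Proof. by rewrite /qnum /qint rmorph_sum; apply: eq_bigr => i _; rewrite rmorphXn. Qed.

Lemma qfac_mpolyC N m : qfac ('X%:MP : {mpoly {poly rat}[N]}) m = (qfact m)%:MP.
Proof. by rewrite /qfac /qfact rmorph_prod; apply: eq_bigr => i _; rewrite qnum_mpolyC. Qed.

(** The product [t^(r-1) (1 + t^(n-r-s))] appears expanded, since [n - r - s] may be negative. *)
Lemma chromX_formula (n r s : nat) (m : nat -> nat)
  (hs : (2 <= s)%N) (hsr : (s <= r)%N) (hrn : (r + 2 <= n)%N)
  (hm1 : m 1%N = r)
  (hm2 : forall i, (2 <= i <= s)%N -> m i = (n - 1)%N)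
  (hm3 : forall i, (s + 1 <= i <= n - 1)%N -> m i = n) N (t : {poly rat} := 'X) :
  chromX m n N = qfact (n - 4) *:
    ((qint n * qint (n - 3) * qint (r - 1) * qint (n - s - 1)) *: e_lam {poly rat} N [:: n]
     + ((2%:R^-1 : rat) *: (qint (n - 2) *
              ((t ^+ (r - 1) + t ^+ (n - s - 1)) * qint (n - 3)
               + t ^+ (n - s - 1) * qint 2 * qint (r - 2) * qint (s - 1)
               + t ^+ (r - 1) * qint 2 * qint (n - r - 1) * qint (n - s - 2))))
         *: e_lam {poly rat} N [:: (n - 1)%N; 1%N]
     + (t ^+ (n + r - s - 3) * qint 2 * qint (n - r - 1) * qint (s - 1))
         *: e_lam {poly rat} N [:: (n - 2)%N; 2%N]).
Proof.
pose x := mvar {poly rat} N.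
rewrite chromX_chrom_rec; last by lia.
rewrite (@chrom_rec_block_formula n r s m hs hsr hrn hm1 hm2 hm3 _ _ x (esym x)); first last.
- by move=> M j; rewrite esym_S.
- exact: esym_M0.
- exact: esym_0.
have cntE z a b : (b <= n)%N -> (forall v, v < n -> (zone n r s v == z) = (a <= v < b))%N ->
    cnt (fun v : 'I_n => zone n r s v) setT z = (b - a)%N.
  move=> bn zE; rewrite -(card_ord_itv a bn); apply: eq_card => v.
  by rewrite !inE zE.
rewrite (cntE 0%N 0%N 1%N); [|lia|by move=> v vn; rewrite /zone; do ! case: ifP => /= ?; lia].
rewrite (cntE 1%N 1%N s); [|lia|by move=> v vn; rewrite /zone; do ! case: ifP => /= ?; lia].
rewrite (cntE 2%N s r); [|lia|by move=> v vn; rewrite /zone; do ! case: ifP => /= ?; lia].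
rewrite (cntE 3%N r n.-1); [|lia|by move=> v vn; rewrite /zone; do ! case: ifP => /= ?; lia].
rewrite (cntE 4%N n.-1 n); [|lia|by move=> v vn; rewrite /zone; do ! case: ifP => /= ?; lia].
have -> : (0 < 1 - 0)%N by [].
have -> : (0 < n - n.-1)%N by lia.
(* The parameters [s - 2], [r - s] and [n - r - 2] remove all truncated subtractions; the blocks
   have sizes [p.+1], [q] and [u.+1]. *)
have [p sE] : exists p, s = p.+2 by exists s.-2; lia.
have [q rE] : exists q, r = (p + q).+2 by exists (r - s)%N; lia.
have [u nE] : exists u, n = (p + q + u).+4 by exists (n - r - 2)%N; lia.
have [-> -> ->] : [/\ (s - 1 = p.+1), (r - s = q) & (n.-1 - r = u.+1)]%N by split; lia.
rewrite block_formula11E /e_lam !big_cons !big_nil !mulr1 !mesym_esym -/x.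
have [-> -> ->] : [/\ (n - 4 = p + q + u), (n - 3 = (p + q + u).+1) & (n - 2 = (p + q + u).+2)]%N by split; lia.
have [-> -> ->] : [/\ (n - 1 = (p + q + u).+3), (r - 1 = (p + q).+1) & (r - 2 = p + q)]%N by split; lia.
have [-> -> ->] : [/\ (n - s - 1 = (q + u).+1), (n - s - 2 = q + u) & (n - r - 1 = u.+1)]%N by split; lia.
have [-> ->] : (n + r - s - 3 = ((p + q).+1 + (q + u).+1).-1)%N /\ n = (p + q + u).+4 by split; lia.
rewrite -[qint]/(qnum 'X) -/t double_C1.
rewrite -scaler_nat scalerA mulVf // scale1r.
rewrite -!mul_mpolyC -qfac_mpolyC !(rmorphXn, rmorphN, rmorphD, rmorphM) /=.
rewrite -[qnum 'X]/qint -!qnum_mpolyC -/t; ring.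
Qed.

(** * Palindromic unimodal polynomials *)

(* Nonnegative combinations of the centred intervals [t^j + ... + t^(d-j)]: this
   form, unlike the inequalities on coefficients, is visibly stable under
   products. *)
Inductive pal_unim (d : nat) : {poly rat} -> Prop :=
| pal_unim0 : pal_unim d 0
| pal_unim_cons (c : rat) j p : 0 <= c -> (j.*2 <= d)%N -> pal_unim d p ->
    pal_unim d (c *: ('X^j * qint (d - j.*2).+1) + p).

Lemma pal_unimD d p p' : pal_unim d p -> pal_unim d p' -> pal_unim d (p + p').
Proof.
move=> hp hp'; elim: hp => [|c j p1 c0 jd _ IH]; first by rewrite add0r.
by rewrite -addrA; apply: pal_unim_cons.
Qed.

Lemma pal_unimZ d c p : 0 <= c -> pal_unim d p -> pal_unim d (c *: p).
Proof.
move=> c0; elim=> [|c' j p1 c'0 jd _ IH]; first by rewrite scaler0; apply: pal_unim0.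
by rewrite scalerDr scalerA; apply: pal_unim_cons => //; apply: mulr_ge0.
Qed.

Lemma pal_unim_basis d j m : d.+1 = (m + j.*2)%N -> (0 < m)%N -> pal_unim d ('X^j * qint m).
Proof.
move=> dE m0; rewrite -[_ * _]addr0 -[_ * _]scale1r.
have -> : m = (d - j.*2).+1 by lia.
by apply: pal_unim_cons => //; [lia|apply: pal_unim0].
Qed.

Lemma pal_unim_qint m : pal_unim m (qint m.+1).
Proof. by rewrite -[qint _]mul1r; apply: (@pal_unim_basis m 0); rewrite // addn0. Qed.

Lemma pal_unimXn j d p : pal_unim d p -> pal_unim (d + j.*2) ('X^j * p).
Proof.
elim=> [|c i p1 c0 id _ IH]; first by rewrite mulr0; apply: pal_unim0.
rewrite mulrDr; apply: pal_unimD => //; rewrite -scalerAr mulrA -exprD.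
by apply: pal_unimZ => //; apply: pal_unim_basis => //; rewrite doubleD; lia.
Qed.

(** [[a+2] [b+2] = [a+b+3] + t [a+1] [b+1]] splits off the longest interval, and the rest has the
    same centre. *)
Lemma pal_unim_qintM a b : pal_unim (a + b) (qint a.+1 * qint b.+1).
Proof.
have q1 : qint 1 = 1 by rewrite -[qint]/(qnum 'X) qnum1.
elim: a b => [|a IH] b; first by rewrite q1 mul1r; apply: pal_unim_qint.
case: b => [|b]; first by rewrite q1 mulr1 addn0; apply: pal_unim_qint.
have -> : qint a.+2 * qint b.+2 = qint (a.+1 + b.+1).+1 + 'X^1 * (qint a.+1 * qint b.+1).
  by rewrite -[qint]/(qnum 'X) !qnumS qnumD !qnumS exprS qnumX; ring.
apply: pal_unimD; first exact: pal_unim_qint.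
have -> : (a.+1 + b.+1 = a + b + 1.*2)%N by lia.
exact: pal_unimXn.
Qed.

Lemma pal_unimM d d' p p' : pal_unim d p -> pal_unim d' p' -> pal_unim (d + d') (p * p').
Proof.
move=> hp hp'; elim: hp => [|c j p1 c0 jd _ IH]; first by rewrite mul0r; apply: pal_unim0.
rewrite mulrDl; apply: pal_unimD => //; rewrite -scalerAl; apply: pal_unimZ => // {IH p1 c c0}.
elim: hp' => [|c i p1 c0 id _ IH]; first by rewrite mulr0; apply: pal_unim0.
rewrite mulrDr; apply: pal_unimD => //; rewrite -scalerAr; apply: pal_unimZ => //.
have -> : (d + d' = (d - j.*2) + (d' - i.*2) + (i + j).*2)%N by rewrite doubleD; lia.
have -> : 'X^j * qint (d - j.*2).+1 * ('X^i * qint (d' - i.*2).+1)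
  = 'X^(i + j) * (qint (d - j.*2).+1 * qint (d' - i.*2).+1) by rewrite exprD; ring.
by apply: pal_unimXn; apply: pal_unim_qintM.
Qed.

Lemma pal_unim_qfact m : pal_unim 'C(m, 2) (qfact m).
Proof.
elim: m => [|m IH]; first by rewrite /qfact big_ord0 -(qnum1 'X); apply: pal_unim_qint.
by rewrite -[qfact]/(qfac 'X) qfacS binS bin1; apply: pal_unimM => //; apply: pal_unim_qint.
Qed.

(* [(1 + t^i) [m+1] = [m+1+i] + t^i [m+1-i]] for [i <= m]. *)
Lemma pal_unim_twoXn m a b : (a <= b + m)%N -> (b <= a + m)%N ->
  pal_unim (m + a + b) (('X^a + 'X^b) * qint m.+1).
Proof.
wlog ab : a b / (a <= b)%N => [H|] am bm.
  case: (leqP a b) => [|/ltnW] ab; first exact: H.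
  by rewrite addrC addnAC; apply: H.
have -> : ('X^a + 'X^b) * qint m.+1 =
    'X^a * (qint (m + (b - a)).+1 + 'X^(b - a) * qint (m - (b - a)).+1).
  rewrite -{1}(subnKC ab) exprD; move: (b - a)%N (leq_subLR b a m) => i; rewrite bm => im.
  have -> : m.+1 = (i + (m - i).+1)%N by lia.
  have -> : (m + i).+1 = (i + (m - i).+1 + i)%N by lia.
  by rewrite -[qint]/(qnum 'X) !qnumD !qnumX !qnumD !qnumX; ring.
have -> : (m + a + b = m + (b - a) + a.*2)%N by lia.
apply: pal_unimXn; apply: pal_unimD; first exact: pal_unim_qint.
by apply: pal_unim_basis; lia.
Qed.

Lemma coef_qint m i : (qint m)`_i = (i < m)%N%:R.
Proof.
rewrite /qint coef_sum; under eq_bigr do rewrite coefXn.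
case: ltnP => im.
  rewrite (bigD1 (Ordinal im)) //= eqxx big1 ?addr0 // => j.
  by rewrite -val_eqE /= eq_sym => /negbTE ->.
by apply: big1 => j _; rewrite eqn_leq leqNgt (leq_trans (ltn_ord j) im).
Qed.

Lemma coef_basis j m i : ('X^j * qint m)`_i = (j <= i < j + m)%N%:R.
Proof.
rewrite coefXnM coef_qint; case: ltnP => ij //=.
by rewrite ltn_subLR.
Qed.

Lemma pal_unim_coef d p : pal_unim d p ->
  [/\ forall i, 0 <= p`_i,
      forall i, (i <= d)%N -> p`_i = p`_(d - i),
      forall i, (d < i)%N -> p`_i = 0
    & forall i, (2 * i < d)%N -> p`_i <= p`_i.+1].
Proof.
elim=> [|c j p1 c0 jd _ [h1 h2 h3 h4]]; first by split=> *; rewrite !coef0.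
split=> i => [|id|id|id]; rewrite !coefD !coefZ !coef_basis.
- by apply: addr_ge0 => //; apply: mulr_ge0 => //; apply: ler0n.
- by rewrite -h2 //; congr (_ * _%:R + _); lia.
- by rewrite h3 // addr0 (_ : (_ <= _ < _)%N = false) ?mulr0 //; lia.
(* Below the centre, an interval from [j] to [d - j] that contains [i] also contains [i + 1]. *)
- apply: lerD; last exact: h4.
  apply: ler_wpM2l => //; rewrite ler_nat; lia.
Qed.

(** * From centred polynomials to e-positivity and e-unimodality *)

Lemma e_lam_map N (lam : seq nat) :
  e_lam {poly rat} N lam = map_mpoly polyC (e_lam rat N lam).
Proof.
rewrite /e_lam rmorph_prod /=; apply: eq_bigr => k _; apply/mpolyP => mm.
by rewrite mcoeff_map_mpoly /= !mcoeff_mesym polyC_natr.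
Qed.

(** Coefficient extraction is only additive, but the coefficients of [e_lam] are constant in [t], so
    it acts on [c] alone. *)
Lemma map_coef_scale_e_lam N (lam : seq nat) (c : {poly rat}) i :
  map_mpoly (coefp i) (c *: e_lam {poly rat} N lam) = c`_i *: e_lam rat N lam.
Proof.
apply/mpolyP => mm; rewrite mcoeff_map_mpoly mcoeffZ [RHS]mcoeffZ e_lam_map.
by rewrite mcoeff_map_mpoly /= coefMC.
Qed.

(** One expansion [l] serves every [N], so all conditions reduce termwise to those of
    [pal_unim_coef]. *)
Lemma pal_unim_e_unimodal (X : symfun {poly rat}) d (l : seq (seq nat * {poly rat})) :
  (forall N, X N = \sum_(p <- l) p.2 *: e_lam {poly rat} N p.1) ->
  (forall p, p \in l -> pal_unim d p.2 /\ all (fun k => 0 < k)%N p.1) ->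
  e_positive X /\ e_unimodal X d.
Proof.
move=> XE lP.
have tE i N : tcoef X i N = \sum_(p <- l) p.2`_i *: e_lam rat N p.1.
  rewrite /tcoef -[LHS]/(map_mpoly (coefp i) (X N)) XE raddf_sum.
  by apply: eq_bigr => p _; apply: map_coef_scale_e_lam.
split; last split; [|move=> N i id|split=> [N i id|i id]].
- move=> i; exists [seq (p.1, p.2`_i) | p : seq nat * {poly rat} <- l];
  split=> [p /mapP[[lam c] pl ->] /=|N].
    by have [/pal_unim_coef[h _ _ _] ?] := lP _ pl.
  by rewrite tE big_map.
- rewrite !tE; apply: eq_big_seq => p /lP[/pal_unim_coef[_ h _ _] _].
  by rewrite -h.
- rewrite tE; apply: big1_seq => p /= /lP[/pal_unim_coef[_ _ h _] _].
  by rewrite h // scale0r.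
- exists [seq (p.1, p.2`_i.+1 - p.2`_i) | p : seq nat * {poly rat} <- l];
  split=> [p /mapP[[lam c] pl ->] /=|N].
    have [/pal_unim_coef[_ _ _ h] ?] := lP _ pl.
    by rewrite subr_ge0 h.
  by rewrite !tE big_map -sumrB; apply: eq_bigr => p _; rewrite scalerBl.
Qed.

Theorem theorem4p5 (n r s : nat) (m : nat -> nat)
  (hs : (2 <= s)%N) (hsr : (s <= r)%N) (hrn : (r + 2 <= n)%N)
  (hm1 : m 1%N = r)
  (hm2 : forall i, (2 <= i <= s)%N -> m i = (n - 1)%N)
  (hm3 : forall i, (s + 1 <= i <= n - 1)%N -> m i = n) :
  let t : {poly rat} := 'X in
  let Cn := qint n * qint (n - 3) * qint (r - 1) * qint (n - s - 1) in
  let C2 := t ^+ (n + r - s - 3) * qint 2 * qint (n - r - 1) * qint (s - 1) in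
  let C1 := (2%:R^-1 : rat) *: (qint (n - 2) *
              ((t ^+ (r - 1) + t ^+ (n - s - 1)) * qint (n - 3)
               + t ^+ (n - s - 1) * qint 2 * qint (r - 2) * qint (s - 1)
               + t ^+ (r - 1) * qint 2 * qint (n - r - 1) * qint (n - s - 2))) in
  let X : symfun {poly rat} := fun N => chromX m n N in
  (forall N : nat,
     X N = qfact (n - 4) *: (Cn *: e_lam {poly rat} N [:: n]
                            + C1 *: e_lam {poly rat} N [:: (n - 1)%N; 1%N]
                            + C2 *: e_lam {poly rat} N [:: (n - 2)%N; 2%N]))
  /\ e_positive X
  /\ e_unimodal X ('C(n, 2) - (n - r + s - 1))%N.
Proof.
move=> t Cn C2 C1 X.
have XE N : X N = _ := chromX_formula hs hsr hrn hm1 hm2 hm3 N.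
split; first exact: XE.
pose l := [:: ([:: n], qfact (n - 4) * Cn); ([:: (n - 1)%N; 1%N], qfact (n - 4) * C1);
              ([:: (n - 2)%N; 2%N], qfact (n - 4) * C2)].
apply: (@pal_unim_e_unimodal X _ l) => [N|].
  by rewrite XE !big_cons big_nil addr0 !scalerDr !scalerA addrA.
have [p sE] : exists p, s = p.+2 by exists s.-2; lia.
have [q rE] : exists q, r = (p + q).+2 by exists (r - s)%N; lia.
have [u nE] : exists u, n = (p + q + u).+4 by exists (n - r - 2)%N; lia.
(* [d] is the degree of [Cn], twice the centre shared by [Cn], [C1] and [C2]; [qfact (n - 4)]
   contributes ['C(n - 4, 2)]. *)
pose d := (p + q + q + u + ((p + q + u).*2.+1 + 2))%N.
have -> : ('C(n, 2) - (n - r + s - 1) = 'C(n - 4, 2) + d)%N.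
  have -> : (n - 4 = p + q + u)%N by lia.
  by rewrite nE !binS !bin1 !bin0 /d; lia.
have qP a : (0 < a)%N -> pal_unim a.-1 (qint a) by case: a => // a _; apply: pal_unim_qint.
have lP c : pal_unim d c -> pal_unim ('C(n - 4, 2) + d) (qfact (n - 4) * c).
  by apply: pal_unimM; apply: pal_unim_qfact.
have CnP : pal_unim d Cn.
  have -> : (d = n.-1 + (n - 3).-1 + (r - 1).-1 + (n - s - 1).-1)%N by lia.
  by do ! [apply: pal_unimM | exact: (pal_unim_qint 1) | apply: qP]; lia.
have C2P : pal_unim d C2.
  have -> : (d = 1 + (n - r - 1).-1 + (s - 1).-1 + (n + r - s - 3).*2)%N by lia.
  rewrite /C2 -!mulrA; apply: pal_unimXn; rewrite !mulrA.
  by do ! [apply: pal_unimM | exact: (pal_unim_qint 1) | apply: qP]; lia.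
have C1P : pal_unim d C1.
  have -> : (d = (n - 2).-1 + (d - (n - 2).-1))%N by lia.
  apply: pal_unimZ => //; apply: pal_unimM; first by apply: qP; lia.
  apply: pal_unimD; first apply: pal_unimD.
  (* The exponents [r - 1] and [n - s - 1] differ by at most [n - 4], as [pal_unim_twoXn]
     requires. *)
  - have -> : (d - (n - 2).-1 = (n - 4) + (r - 1) + (n - s - 1))%N by lia.
    have -> : (n - 3 = (n - 4).+1)%N by lia.
    by apply: pal_unim_twoXn; lia.
  (* For [r = 2] the summand is zero and [(r - 2).-1] would give a wrong degree; likewise below for
     [n - s = 2]. *)
  - case: (posnP (r - 2)) => [->|r2].
      by rewrite /qint big_ord0 mulr0 mul0r; apply: pal_unim0.
    have -> : (d - (n - 2).-1 = 1 + (r - 2).-1 + (s - 1).-1 + (n - s - 1).*2)%N by lia.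
    rewrite -!mulrA; apply: pal_unimXn; rewrite !mulrA.
    by do ! [apply: pal_unimM | exact: (pal_unim_qint 1) | apply: qP]; lia.
  - case: (posnP (n - s - 2)) => [->|r2].
      by rewrite [qint 0]big_ord0 mulr0; apply: pal_unim0.
    have -> : (d - (n - 2).-1 = 1 + (n - r - 1).-1 + (n - s - 2).-1 + (r - 1).*2)%N by lia.
    rewrite -!mulrA; apply: pal_unimXn; rewrite !mulrA.
    by do ! [apply: pal_unimM | exact: (pal_unim_qint 1) | apply: qP]; lia.
move=> c; rewrite !inE => /or3P[] /eqP -> /=; split; rewrite ?andbT; by [lia|apply: lP].
Qed.
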